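(* Let $\varepsilon\in(0,1)$ and $d\in[0,1]$ be real numbers, and let $G$ be a finite simple graph that is $(\varepsilon,d)$-dense and has at least $\frac{2}{\varepsilon-\varepsilon^2}$ vertices. Then for every odd integer $r\ge 3$ we have $C_r(G)\ge (d^r-\varepsilon)\,|V(G)|^r$.
   Context: A graph $G$ on $n$ vertices is called $(\varepsilon,d)$-dense if every subset $X\subseteq V(G)$ with $|X|\ge \varepsilon n$ spans at least $\frac d2|X|^2$ edges. For an integer $r\ge 2$, $C_r(G)$ denotes the number of sequences $(x_1,\dots,x_r)\in V(G)^r$ such that $x_1x_2, x_2x_3,\dots,x_{r-1}x_r, x_rx_1$ are all edges of $G$ (i.e. the number of homomorphisms from the $r$-cycle into $G$). *)

(* Defs.v *)
From mathcomp Require Import all_boot all_order all_algebra.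
From mathcomp Require Import reals.

Set Implicit Arguments.
Unset Strict Implicit.
Unset Printing Implicit Defensive.

Import Order.TTheory GRing.Theory Num.Theory.

Local Open Scope ring_scope.

Record sgraph := SGraph {
  svertex :> finType;
  sedge : rel svertex;
  sedge_sym : symmetric sedge;
  sedge_irrefl : irreflexive sedge }.

Definition spanned_edges (G : sgraph) (X : {set G}) : {set {set G}} :=
  [set [set x; y] | x in X, y in X & sedge x y].

Definition graph_dense (R : realType) (eps d : R) (G : sgraph) : Prop :=
  forall X : {set G}, eps * #|G|%:R <= #|X|%:R ->
    d / 2%:R * #|X|%:R ^+ 2 <= #|spanned_edges X|%:R.

(* [cycle e [:: x_1; ..; x_r]] asserts e x_1 x_2, .., e x_(r-1) x_r, e x_r x_1,
   with repetitions among the x_i allowed. *)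
Definition num_cycle_homs (G : sgraph) (r : nat) : nat :=
  #|[set x : r.-tuple G | cycle (@sedge G) x]|.

(* Main.v *)
Require Import Defs.
From mathcomp Require Import all_boot all_order all_algebra.
From mathcomp Require Import reals.
From mathcomp Require Import ring lra zify.

Set Implicit Arguments.
Unset Strict Implicit.
Unset Printing Implicit Defensive.

Import Order.TTheory GRing.Theory Num.Theory.

Local Open Scope ring_scope.

(** Let [f_x y] be the number of walks of length [k] from [x] to [y], and write
  [r = 2k + 1].  Then [C_r(G)] is the sum over [x] of the quadratic form of the
  adjacency matrix at [f_x].  Since [f_x <= n ^ (k - 1)], density bounds this
  form below by [d * (\sum_y f_x y) ^ 2 - eps * n ^ (2 * k)], once it is
  extended from indicator functions to all functions with values in [0, 1]: a
  function can be rounded to an indicator function without increasing the form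
  and losing less than 1 in total mass, and the hypothesis on [n] absorbs this
  loss together with the functions of mass below [eps * n + 1].  Summing over
  [x], it remains to bound below the number of walks of length [2k] by
  [d ^ (2k) * n ^ (2k + 1)], which follows from the log-convexity of
  [k |-> \sum_x (\sum_y f_x y) ^ 2]. *)

(** Lagrange's identity: twice the gap between the two sides is a double sum of squares. *)
Lemma sum_cauchy_schwarz (R : realDomainType) (T : finType) (f g : T -> R) :
  (\sum_x f x * g x) ^+ 2 <= (\sum_x f x ^+ 2) * (\sum_x g x ^+ 2).
Proof.
have : 0 <= \sum_x \sum_y (f x * g y - f y * g x) ^+ 2.
  by apply: sumr_ge0 => x _; apply: sumr_ge0 => y _; apply: sqr_ge0.
suff -> : \sum_x \sum_y (f x * g y - f y * g x) ^+ 2 =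
    2 * ((\sum_x f x ^+ 2) * (\sum_x g x ^+ 2) - (\sum_x f x * g x) ^+ 2).
  by rewrite pmulr_rge0 ?ltr0n// subr_ge0.
have expand (u v : T -> R) :
    (\sum_x u x) * (\sum_x v x) = \sum_x \sum_y u x * v y.
  by rewrite big_distrl/=; apply: eq_bigr => x _; rewrite big_distrr.
have swap (u v : T -> R) : (\sum_x \sum_y u x * v y) = \sum_x \sum_y u y * v x.
  by rewrite exchange_big.
rewrite mulrBr mulr2n !mulrDl !mul1r expr2 !expand [in X in _ + X - _]swap.
rewrite -!big_split -sumrB /=; apply: eq_bigr => x _.
rewrite -!big_split -sumrB /=; apply: eq_bigr => y _.
ring.
Qed.

(** * Bilinear form and weighted walks of a kernel *)

Section Kernel.
Variables (R : realDomainType) (T : finType) (K : T -> T -> R).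

Definition bilin (f g : T -> R) : R := \sum_x \sum_y K x y * f x * g y.

(** The entries of the [k]-th power of the matrix [K]. *)
Fixpoint walks (k : nat) (x y : T) : R :=
  if k is j.+1 then \sum_z K x z * walks j z y else (x == y)%:R.

Definition walks_from (k : nat) (x : T) : R := \sum_y walks k x y.

Lemma sum_delta (x : T) (F : T -> R) : \sum_z (x == z)%:R * F z = F x.
Proof.
rewrite (bigD1 x)//= eqxx mul1r big1 ?addr0// => z /negPf.
by rewrite eq_sym => ->; rewrite mul0r.
Qed.

Lemma bilinDZ (f g : T -> R) (t : R) :
  bilin (fun x => f x + t * g x) (fun x => f x + t * g x) =
  bilin f f + t * (bilin f g + bilin g f) + t ^+ 2 * bilin g g.
Proof.
rewrite /bilin mulrDr !mulr_sumr -!big_split; apply: eq_bigr => x _ /=.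
rewrite !mulr_sumr -!big_split; apply: eq_bigr => y _ /=.
ring.
Qed.

(** The first argument is the direction in which [bilin_shift_le] moves mass. *)
Lemma bilin_swap (x y : T) (g : T -> R) :
  bilin (fun z => (x == z)%:R - (y == z)%:R) g =
  \sum_z K x z * g z - \sum_z K y z * g z.
Proof.
rewrite /bilin.
under eq_bigr => a _.
  under eq_bigr do rewrite -mulrA mulrCA.
  rewrite -mulr_sumr mulrBl.
  over.
by rewrite sumrB !sum_delta.
Qed.

Lemma walks_add (a b : nat) (x y : T) :
  walks (a + b) x y = \sum_z walks a x z * walks b z y.
Proof.
elim: a x => [|a IH] x; first by rewrite sum_delta.
rewrite addSn /=; under eq_bigr do rewrite IH mulr_sumr.
rewrite exchange_big; apply: eq_bigr => z _ /=.
by rewrite mulr_suml; apply: eq_bigr => u _; rewrite mulrA.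
Qed.

Lemma walksS (k : nat) (x y : T) :
  walks k.+1 x y = \sum_z K x z * walks k z y.
Proof. by []. Qed.

Lemma walks1 (x y : T) : walks 1 x y = K x y.
Proof.
rewrite /=; under eq_bigr do rewrite mulrC eq_sym.
by rewrite sum_delta.
Qed.

Lemma walks_from0 (x : T) : walks_from 0 x = 1.
Proof.
rewrite /walks_from /=; under eq_bigr do rewrite -[_%:R]mulr1.
exact: sum_delta.
Qed.

Lemma walks_fromS (k : nat) (x : T) :
  walks_from k.+1 x = \sum_z K x z * walks_from k z.
Proof.
by rewrite /walks_from /= exchange_big; apply: eq_bigr => z _; rewrite mulr_sumr.
Qed.

Hypothesis K_sym : forall x y, K x y = K y x.

Lemma bilinC (f g : T -> R) : bilin f g = bilin g f.
Proof.
rewrite /bilin exchange_big; apply: eq_bigr => x _; apply: eq_bigr => y _ /=.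
by rewrite K_sym mulrAC.
Qed.

Lemma walks_sym (k : nat) (x y : T) : walks k x y = walks k y x.
Proof.
elim: k x y => [|k IH] x y; first by rewrite /= eq_sym.
rewrite -[in RHS]addn1 walks_add /=; apply: eq_bigr => z _.
by rewrite -/(walks 1 z x) walks1 mulrC K_sym IH.
Qed.

(** Removing the edge opposite to [x] cuts a closed walk of length [2k + 1] into two walks of length
    [k] that start at [x]. *)
Lemma walks_closed_odd (k : nat) (x : T) :
  walks (k + k.+1) x x = bilin (walks k x) (walks k x).
Proof.
rewrite walks_add; apply: eq_bigr => y _ /=; rewrite mulr_sumr.
by apply: eq_bigr => z _; rewrite (walks_sym k z) mulrCA mulrA.
Qed.

Hypothesis K_ge0 : forall x y, 0 <= K x y.

Lemma bilin_le (f g : T -> R) : (forall x, 0 <= f x) ->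
  (forall x, f x <= g x) -> bilin f f <= bilin g g.
Proof.
move=> f_ge0 fg; apply: ler_sum => x _; apply: ler_sum => y _.
by rewrite -!mulrA ler_wpM2l// ler_pM.
Qed.

Lemma bilin_ge0 (f g : T -> R) : (forall x, 0 <= f x) -> (forall x, 0 <= g x) ->
  0 <= bilin f g.
Proof. by move=> ? ?; do 2!apply: sumr_ge0 => ? _; rewrite !mulr_ge0. Qed.

Lemma walks_ge0 (k : nat) (x y : T) : 0 <= walks k x y.
Proof.
elim: k x => [|k IH] x /=; first exact: ler0n.
by apply: sumr_ge0 => z _; rewrite mulr_ge0.
Qed.

(** By symmetry of [K], one step can be moved from one factor of the square to the other;
    Cauchy-Schwarz then applies to the mixed sum. *)
Lemma sum_walks_from_logconvex (k : nat) :
  (\sum_x walks_from k.+1 x ^+ 2) ^+ 2 <=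
  (\sum_x walks_from k x ^+ 2) * (\sum_x walks_from k.+2 x ^+ 2).
Proof.
suff -> : \sum_x walks_from k.+1 x ^+ 2 =
    \sum_x walks_from k x * walks_from k.+2 x by exact: sum_cauchy_schwarz.
under [RHS]eq_bigr do rewrite walks_fromS mulr_sumr.
rewrite exchange_big; apply: eq_bigr => x _ /=.
rewrite expr2 [X in X * _]walks_fromS mulr_suml; apply: eq_bigr => y _.
by rewrite [K y x]K_sym mulrCA mulrA.
Qed.

(** Log-convexity makes consecutive ratios nondecreasing, so a lower bound on the first ratio
    propagates. *)
Lemma sum_walks_from_ratio (c : R) :
  c * (\sum_x walks_from 0 x ^+ 2) <= \sum_x walks_from 1 x ^+ 2 ->
  forall k, c * (\sum_x walks_from k x ^+ 2) <= \sum_x walks_from k.+1 x ^+ 2.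
Proof.
move=> H0; elim=> // k.
have := sum_walks_from_logconvex k.
have a_ge0 j : 0 <= \sum_x walks_from j x ^+ 2.
  by apply: sumr_ge0 => x _; apply: sqr_ge0.
move: (a_ge0 k) (a_ge0 k.+1) (a_ge0 k.+2).
set a0 := \sum_x walks_from k x ^+ 2; set a1 := \sum_x walks_from k.+1 x ^+ 2.
set a2 := \sum_x walks_from k.+2 x ^+ 2.
(* If [a0] vanishes, log-convexity forces [a1] to vanish too; otherwise [a0] can be cancelled. *)
rewrite le_eqVlt => /orP[/eqP <-|a0_gt0] a1_ge0 a2_ge0 lc IH.
  suff -> : a1 = 0 by rewrite mulr0.
  by apply/eqP; rewrite -sqrf_eq0 eq_le sqr_ge0 andbT; rewrite mul0r in lc.
rewrite -(ler_pM2l a0_gt0); apply: le_trans lc.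
by rewrite mulrCA mulrA expr2 ler_wpM2r.
Qed.

(** Cauchy-Schwarz against the constant 1 bounds the first ratio below by [(c * #|T|%:R) ^+ 2], and
    the sequence starts at [#|T|]. *)
Lemma sum_walks_from_ge (c : R) : 0 <= c ->
  c * #|T|%:R ^+ 2 <= \sum_x walks_from 1 x ->
  forall k, (c * #|T|%:R) ^+ k.*2 * #|T|%:R <= \sum_x walks_from k x ^+ 2.
Proof.
move=> c_ge0 Hc.
have a0 : \sum_x walks_from 0 x ^+ 2 = #|T|%:R.
  under eq_bigr do rewrite walks_from0 expr1n.
  by rewrite sumr_const.
have base : (c * #|T|%:R) ^+ 2 * (\sum_x walks_from 0 x ^+ 2)
    <= \sum_x walks_from 1 x ^+ 2.
  have [T0|T_gt0] := posnP #|T|.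
    rewrite a0 T0 mulr0; apply: sumr_ge0 => x _; exact: sqr_ge0.
  rewrite a0 -(@ler_pM2l _ #|T|%:R) ?ltr0n//.
  have := sum_cauchy_schwarz (fun=> 1) (walks_from 1).
  under eq_bigr do rewrite mul1r.
  under [X in _ <= X * _]eq_bigr do rewrite expr1n.
  rewrite sumr_const; apply: le_trans.
  have -> : #|T|%:R * ((c * #|T|%:R) ^+ 2 * #|T|%:R) =
    (c * #|T|%:R ^+ 2) ^+ 2 by ring.
  have cn_ge0 : 0 <= c * #|T|%:R ^+ 2 by rewrite mulr_ge0 ?exprn_ge0.
  by rewrite ler_sqr// nnegrE// (le_trans cn_ge0).
elim=> [|k IH]; first by rewrite a0 mul1r.
apply: le_trans (sum_walks_from_ratio base k).
by rewrite doubleS -addn2 addnC exprD -mulrA ler_wpM2l// sqr_ge0.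
Qed.

Hypothesis K_le1 : forall x y, K x y <= 1.

(** Once both ends are fixed, only [k] inner vertices remain free. *)
Lemma walksS_le (k : nat) (x y : T) : walks k.+1 x y <= #|T|%:R ^+ k.
Proof.
elim: k x => [|k IH] x; first by rewrite walks1.
rewrite walksS; apply: (@le_trans _ _ (\sum_(z : T) #|T|%:R ^+ k)).
  apply: ler_sum => z _; rewrite -[leRHS]mul1r; apply: ler_pM => //.
  exact: walks_ge0.
by rewrite sumr_const exprS mulr_natl.
Qed.

(** * Rounding a function to an indicator function *)

Hypothesis K_irr : forall x, K x x = 0.

(* Moving mass from y to x changes the form by a concave function of the
   amount moved, since the diagonal of K vanishes. *)
Lemma bilin_shift_le (x y : T) (g : T -> R) (t : R) : 0 <= t ->
  \sum_z K x z * g z <= \sum_z K y z * g z ->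
  bilin (fun z => g z + t * ((x == z)%:R - (y == z)%:R))
    (fun z => g z + t * ((x == z)%:R - (y == z)%:R)) <= bilin g g.
Proof.
move=> t_ge0 xy; rewrite bilinDZ [X in t * (X + _)]bilinC !bilin_swap.
have pick a : \sum_z K a z * ((x == z)%:R - (y == z)%:R) = K a x - K a y.
  under eq_bigr do rewrite mulrC mulrBl.
  by rewrite sumrB !sum_delta.
rewrite !pick !K_irr [K y x]K_sym -addrA gerDl.
(* The form changes by [2 * t * (u - v) - 2 * t ^+ 2 * p], and both terms are nonpositive. *)
move: (K_ge0 x y) xy; set p := K x y.
set u := \sum_z K x z * g z; set v := \sum_z K y z * g z => p_ge0 uv.
have h1 : 0 <= t * (v - u) by rewrite mulr_ge0// subr_ge0.
have h2 : 0 <= t ^+ 2 * p by rewrite mulr_ge0// sqr_ge0.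
lra.
Qed.

(* Rounding: repeatedly shift mass between two vertices with values strictly
   between 0 and 1 until one of them becomes 0 or 1. *)
Lemma bilin_round (g : T -> R) : (forall x, 0 <= g x <= 1) ->
  exists2 X : {set T}, \sum_x g x < #|X|%:R + 1 &
    \sum_(x in X) \sum_(y in X) K x y <= bilin g g.
Proof.
pose fr (g : T -> R) := [set x | (g x != 0) && (g x != 1)].
(* Induction on the number of fractional values. *)
have [n] := ubnP #|fr g|; elim: n => // n IH in g *; rewrite ltnS => fr_n g01.
have [fr_le1|] := leqP #|fr g| 1; last first.
  move=> /card_gt1P[x0 [y0 [fx0 fy0 xy0]]].
  wlog L_xy : x0 y0 fx0 fy0 xy0 / \sum_z K x0 z * g z <= \sum_z K y0 z * g z.
    move=> W; have /orP[L|L] := le_total (\sum_z K x0 z * g z) (\sum_z K y0 z * g z).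
      exact: (W x0 y0).
    by apply: (W y0 x0) => //; rewrite eq_sym.
  move: x0 y0 fx0 fy0 xy0 L_xy => x y fx fy xy L_xy.
  (* The largest shift that keeps both values in [0, 1]: [x] reaches 1 or [y] reaches 0, so a
     fractional value disappears. *)
  pose t := Num.min (1 - g x) (g y).
  have /andP[gx0 gx1] := g01 x; have /andP[gy0 gy1] := g01 y.
  have t_ge0 : 0 <= t by rewrite le_min subr_ge0 gx1.
  have tx : t <= 1 - g x by rewrite ge_min lexx.
  have ty : t <= g y by rewrite ge_min lexx orbT.
  pose h z := g z + t * ((x == z)%:R - (y == z)%:R).
  have hx : h x = g x + t by rewrite /h eqxx eq_sym (negPf xy) subr0 mulr1.
  have hy : h y = g y - t by rewrite /h eqxx (negPf xy) sub0r mulrN1.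
  have hz z : z != x -> z != y -> h z = g z.
    by rewrite /h ![z == _]eq_sym => /negPf-> /negPf->; rewrite subr0 mulr0 addr0.
  have h01 z : 0 <= h z <= 1.
    have [->|zx] := eqVneq z x; first by rewrite hx; apply/andP; split; lra.
    have [->|zy] := eqVneq z y; first by rewrite hy; apply/andP; split; lra.
    by rewrite hz.
  have sum_h : \sum_z h z = \sum_z g z.
    rewrite big_split /= -mulr_sumr sumrB.
    have s1 a : \sum_(z : T) ((a == z)%:R : R) = 1.
      by rewrite -[RHS](sum_delta a (fun=> 1)); apply: eq_bigr => z _; rewrite mulr1.
    by rewrite !s1 subrr mulr0 addr0.
  have fr_h : (#|fr h| < n)%N.
    apply: leq_trans fr_n; apply: proper_card; apply/properP; split.
      apply/subsetP => z; have [->//|zx] := eqVneq z x.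
      by have [->//|zy] := eqVneq z y; rewrite !inE hz.
    have [tE|tE] : t = 1 - g x \/ t = g y by rewrite /t; case: leP; [left|right].
      by exists x => //; rewrite inE hx tE subrKC eqxx andbF.
    by exists y => //; rewrite inE hy tE subrr eqxx.
  have [X X1 X2] := IH h fr_h h01.
  exists X; first by rewrite -sum_h.
  by apply: (le_trans X2); apply: bilin_shift_le.
(* At most one fractional value is left; rounding it down to 0 loses less than 1 in mass and, by
   monotonicity, does not increase the form. *)
exists [set x | g x == 1].
  rewrite (bigID [in [set x | g x == 1]]) /= -sum1_card natr_sum.
  rewrite (eq_bigr (fun=> 1)); last by move=> x; rewrite inE => /eqP.
  rewrite ltrD2l (bigID [in fr g]) /= [X in _ + X]big1 ?addr0; last first.
    by move=> x; rewrite !inE => /andP[/negPf->]; rewrite andbT negbK => /eqP.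
  have -> : \sum_(i | (i \notin [set x | g x == 1]) && (i \in fr g)) g i =
      \sum_(i in fr g) g i.
    by apply: eq_bigl => i; rewrite !inE andbC -andbA andbb.
  have [->|[a fra]] := set_0Vmem (fr g); first by rewrite big_set0 ltr01.
  have -> : fr g = [set a].
    apply/eqP; rewrite eq_sym eqEcard cards1 fr_le1 andbT.
    by apply/subsetP => z /set1P->.
  rewrite big_set1; move: fra; rewrite inE => /andP[_ a1].
  by rewrite lt_neqAle a1; case/andP: (g01 a).
pose f x : R := (g x == 1)%:R.
suff -> : \sum_(x in [set x | g x == 1]) \sum_(y in [set x | g x == 1]) K x y =
    bilin f f.
  apply: bilin_le => x; rewrite /f ?ler0n//.
  by have [->|_] := eqVneq; last case/andP: (g01 x).
rewrite big_mkcond /=; apply: eq_bigr => x _; rewrite /f inE.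
case: eqP => _; last by rewrite big1// => y _; rewrite mulr0 mul0r.
rewrite big_mkcond /=; apply: eq_bigr => y _; rewrite inE mulr1.
by case: eqP => _; rewrite ?mulr1 ?mulr0.
Qed.

End Kernel.

(** * Cycle homomorphisms and spanned edges in terms of the adjacency kernel *)

Lemma sum_tupleS (R : nmodType) (T : finType) (n : nat)
    (F : n.+1.-tuple T -> R) :
  \sum_t F t = \sum_x \sum_(t : n.-tuple T) F [tuple of x :: t].
Proof.
rewrite pair_big /= (reindex (fun p : T * n.-tuple T => [tuple of p.1 :: p.2])) //.
exists (fun t => (thead t, [tuple of behead t])) => [[x t] _|t _] /=.
  by rewrite theadE; congr pair; apply: val_inj.
by rewrite [RHS]tuple_eta.
Qed.

Section Graph.
Variables (R : realDomainType) (G : sgraph).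

Definition adj (x y : G) : R := (sedge x y)%:R.

Lemma adj_sym (x y : G) : adj x y = adj y x.
Proof. by rewrite /adj sedge_sym. Qed.

Lemma adj_ge0 (x y : G) : 0 <= adj x y.
Proof. exact: ler0n. Qed.

Lemma adj_le1 (x y : G) : adj x y <= 1.
Proof. by rewrite /adj lern1 leq_b1. Qed.

Lemma adj_irr (x : G) : adj x x = 0.
Proof. by rewrite /adj sedge_irrefl. Qed.

(** The weight [f] at the endpoint makes room for the closing edge of a cycle. *)
Lemma sum_paths (k : nat) (x : G) (f : G -> R) :
  \sum_(p : k.-tuple G) (path (@sedge G) x p)%:R * f (last x p) =
  \sum_y walks adj k x y * f y.
Proof.
elim: k x => [|k IH] x.
  rewrite sum_delta (big_pred1 [tuple]) ?mul1r// => t.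
  by rewrite [t]tuple0; apply/esym/eqP.
rewrite sum_tupleS; under [RHS]eq_bigr do rewrite walksS mulr_suml.
rewrite [RHS]exchange_big; apply: eq_bigr => z _ /=.
under [RHS]eq_bigr do rewrite -mulrA.
rewrite -mulr_sumr -IH mulr_sumr; apply: eq_bigr => p _.
by rewrite mulrA /adj -natrM mulnb.
Qed.

Lemma num_cycle_homsE (k : nat) :
  (num_cycle_homs G k.+1)%:R = \sum_x walks adj k.+1 x x :> R.
Proof.
rewrite /num_cycle_homs -sum1_card natr_sum big_mkcond sum_tupleS.
apply: eq_bigr => x _.
transitivity (\sum_(p : k.-tuple G)
    (path (@sedge G) x p)%:R * adj (last x p) x : R).
  apply: eq_bigr => p _; rewrite inE /= rcons_path /adj -natrM mulnb.
  by case: (_ && _).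
rewrite (sum_paths k x (adj^~ x)) -[k.+1]addn1 walks_add.
by apply: eq_bigr => y _; rewrite walks1.
Qed.

(** As there are no loops, every spanned edge arises from two distinct ordered pairs. *)
Lemma spanned_edges_le (X : {set G}) :
  2 * #|spanned_edges X|%:R <= \sum_(x in X) \sum_(y in X) adj x y.
Proof.
pose P := [set p : G * G | [&& p.1 \in X, p.2 \in X & sedge p.1 p.2]].
have -> : \sum_(x in X) \sum_(y in X) adj x y = #|P|%:R.
  rewrite pair_big /= -sum1_card natr_sum [RHS]big_mkcond [LHS]big_mkcond /=.
  apply: eq_bigr => -[x y] _; rewrite inE /= /adj.
  by do 2!case: (_ \in X) => //=; case: sedge.
rewrite -natrM ler_nat -[#|P|]sum1_card.
rewrite (partition_big (fun p => [set p.1; p.2])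
  [in spanned_edges X]) /=; last first.
  move=> [x y]; rewrite inE /= => /and3P[xX yX xy].
  by apply/imset2P; exists x y; rewrite ?inE ?yX.
rewrite mulnC -sum_nat_const; apply: leq_sum => j /imset2P[x y xX].
rewrite inE => /andP[yX xy] ->.
have xNy : x != y by apply: contraTneq xy => ->; rewrite sedge_irrefl.
rewrite sum1_card; apply: leq_trans (subset_leq_card
  (_ : [set (x, y); (y, x)] \subset _)).
  by rewrite cards2 xpair_eqE (negPf xNy).
apply/subsetP => p /set2P[] ->; rewrite unfold_in /= inE /=.
  by rewrite xX yX xy eqxx.
by rewrite xX yX sedge_sym xy setUC eqxx.
Qed.

End Graph.

(** * Lower bounds from density *)

Section Dense.
Variables (R : realType) (eps d : R) (G : sgraph).
Hypotheses (eps_gt0 : 0 < eps) (eps_lt1 : eps < 1).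
Hypotheses (d_ge0 : 0 <= d) (d_le1 : d <= 1).
Hypothesis G_dense : graph_dense eps d G.

Local Notation n := (#|G|%:R : R).
Local Notation adj := (@adj R G).

Lemma dense_adj (X : {set G}) : eps * n <= #|X|%:R ->
  d * #|X|%:R ^+ 2 <= \sum_(x in X) \sum_(y in X) adj x y.
Proof.
move=> /G_dense dX; apply: le_trans (spanned_edges_le R X).
lra.
Qed.

Hypothesis G_large : 2%:R / (eps - eps ^+ 2) <= n.

Lemma large2 : 2 <= (eps - eps ^+ 2) * n.
Proof.
by rewrite mulrC -ler_pdivrMr// subr_gt0 expr2 gtr_pMr.
Qed.

Lemma large_gt0 : 0 < n.
Proof.
apply: lt_le_trans G_large; rewrite divr_gt0 ?ltr0n//.
by rewrite subr_gt0 expr2 gtr_pMr.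
Qed.

Lemma dense_bilin01 (g : G -> R) : (forall x, 0 <= g x <= 1) ->
  d * (\sum_x g x) ^+ 2 - eps * n ^+ 2 <= bilin adj g g.
Proof.
move=> g01.
have [X sX QX] := bilin_round (@adj_sym R G) (@adj_ge0 R G) (@adj_irr R G) g01.
have n2 := large2; have n_gt0 := large_gt0.
have s_ge0 : 0 <= \sum_x g x by apply: sumr_ge0 => x _; case/andP: (g01 x).
have s_le : \sum_x g x <= n.
  apply: (@le_trans _ _ (\sum_(x : G) 1)); last by rewrite sumr_const.
  by apply: ler_sum => x _; case/andP: (g01 x).
have Q_ge0 : 0 <= bilin adj g g.
  by apply: bilin_ge0 => [|x|x]; [exact: adj_ge0 | case/andP: (g01 x)..].
move: sX QX s_ge0 s_le Q_ge0; set s := \sum_x g x; set Q := bilin _ _ _.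
move=> sX QX s_ge0 s_le Q_ge0.
have n22 : 2 * n <= (eps - eps ^+ 2) * n ^+ 2.
  by rewrite [n ^+ 2]expr2 mulrA ler_pM2r.
(* Above this threshold the rounded set still has at least [eps * n] elements, since rounding loses
   less than 1; below it the left-hand side is nonpositive. *)
have [s_small|s_big] := leP s (eps * n + 1).
  suff : d * s ^+ 2 <= eps * n ^+ 2 by lra.
  apply: (@le_trans _ _ ((eps * n + 1) ^+ 2)).
    rewrite -[leRHS]mul1r ler_pM// ?sqr_ge0// ler_sqr// nnegrE.
    exact: le_trans s_small.
  suff : 2 * (eps * n) + 1 <= 2 * n by nra.
  nra.
have X_big : eps * n <= #|X|%:R by lra.
have en_ge0 : 0 <= eps * n by rewrite mulr_ge0 ?ltW.
(* Replacing [s] by [s - 1] costs at most [2 * d * s <= 2 * n], which [n22] bounds by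
   [eps * n ^+ 2]. *)
have s1 : (s - 1) ^+ 2 <= #|X|%:R ^+ 2.
  by rewrite ler_sqr ?nnegrE; lra.
have {}QX := le_trans (dense_adj X_big) QX.
have {}s1 : d * (s - 1) ^+ 2 <= d * #|X|%:R ^+ 2 by rewrite ler_wpM2l.
have ds : d * s <= s by rewrite -[leRHS]mul1r ler_wpM2r.
have e2 : 0 <= eps ^+ 2 * n ^+ 2 by rewrite mulr_ge0// sqr_ge0.
nra.
Qed.

(** Both sides are homogeneous of degree 2 in [f] and [M] jointly, so this reduces to [M = 1]. *)
Lemma dense_bilin (M : R) (f : G -> R) : 0 < M ->
  (forall x, 0 <= f x <= M) ->
  d * (\sum_x f x) ^+ 2 - eps * n ^+ 2 * M ^+ 2 <= bilin adj f f.
Proof.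
move=> M_gt0 f0M; pose g x := f x / M.
have fE x : f x = M * g x by rewrite /g mulrC divfK// gt_eqF.
have g01 x : 0 <= g x <= 1.
  have /andP[f0 fM] := f0M x.
  by rewrite divr_ge0 ?(ltW M_gt0)//= ler_pdivrMr// mul1r.
have -> : bilin adj f f = M ^+ 2 * bilin adj g g.
  rewrite /bilin mulr_sumr; apply: eq_bigr => x _.
  by rewrite mulr_sumr; apply: eq_bigr => y _; rewrite !fE; ring.
under eq_bigr do rewrite fE.
rewrite -mulr_sumr.
have -> : d * (M * \sum_x g x) ^+ 2 - eps * n ^+ 2 * M ^+ 2 =
  M ^+ 2 * (d * (\sum_x g x) ^+ 2 - eps * n ^+ 2) by ring.
by rewrite ler_pM2l ?exprn_gt0// dense_bilin01.
Qed.

Lemma dense_odd_cycles (k : nat) :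
  (d ^+ (k.+1.*2).+1 - eps) * n ^+ (k.+1.*2).+1 <=
  (num_cycle_homs G (k.+1.*2).+1)%:R.
Proof.
have n_gt0 := large_gt0.
rewrite num_cycle_homsE -addnn -addnS.
under eq_bigr do rewrite (walks_closed_odd (@adj_sym R G)).
(* Here [M] is [n ^+ k], the bound of [walksS_le]; summed over [x], the error terms give exactly
   [eps * n ^+ r] with [r = 2k + 3]. *)
have cyc (x : G) : d * walks_from adj k.+1 x ^+ 2 - eps * n ^+ 2 * (n ^+ k) ^+ 2 <=
    bilin adj (walks adj k.+1 x) (walks adj k.+1 x).
  apply: dense_bilin => [|y]; first exact: exprn_gt0.
  by rewrite walks_ge0 ?walksS_le//; exact: adj_le1.
apply: le_trans (ler_sum _ (fun x _ => cyc x)).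
rewrite sumrB -mulr_sumr sumr_const.
have nE : (eps * n ^+ 2 * (n ^+ k) ^+ 2) *+ #|G| = eps * n ^+ (k.+1 + k.+2).
  rewrite -mulr_natr -[_ * _ * _ * n]mulrA -mulrA -exprM -exprSr -exprD.
  by congr (_ * n ^+ _); lia.
rewrite nE mulrBl lerB// -addSnnS addSn exprS addnn.
rewrite -mulrA ler_wpM2l//.
have := sum_walks_from_ge (@adj_sym R G) d_ge0 _ k.+1.
rewrite exprMn -mulrA -exprSr; apply.
(* Density of the whole vertex set, which is large enough because [eps < 1], supplies the bound on
   walks of length 1. *)
have := @dense_adj [set: G]; rewrite cardsT => dG.
apply: le_trans (dG _) _; first by rewrite ler_piMl// ltW.
rewrite le_eqVlt; apply/orP; left; apply/eqP.
apply: eq_big => [x|x _]; first by rewrite inE.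
by apply: eq_big => [y|y _]; rewrite ?inE ?walks1.
Qed.

End Dense.

Theorem theorem1p3 (R : realType) (eps d : R) (G : sgraph)
  (eps_gt0 : 0 < eps) (eps_lt1 : eps < 1)
  (d_ge0 : 0 <= d) (d_le1 : d <= 1)
  (G_dense : graph_dense eps d G)
  (G_large : 2%:R / (eps - eps ^+ 2) <= #|G|%:R)
  (r : nat) (r_odd : odd r) (r_ge3 : (3 <= r)%N) :
  (d ^+ r - eps) * #|G|%:R ^+ r <= (num_cycle_homs G r)%:R.
Proof.
(* Since [r] is at least 3, the half-walks have positive length, as [walksS_le] requires. *)
have [k ->] : exists k, r = (k.+1.*2).+1.
  exists r./2.-1; rewrite prednK ?half_gt0 ?(ltnW r_ge3)// odd_halfK//.
  by rewrite prednK// odd_gt0.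
exact: dense_odd_cycles.
Qed.
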